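(* Let $p\ge1$ be an integer, $I\ge 2$, $\mathcal I=\{1,\dots,I\}$, $N\ge 1$, let $\bar a_k,\bar b_{ik}\in\mathbb R$ and $q_{ik},q_{iN},r_{ik},\bar q_{ik},\bar q_{iN},\bar r_{ik}>0$ for $i\in\mathcal I$, $k\in\{0,\dots,N-1\}$. Let $\{\epsilon_k\}_k$ be a zero-mean real random process with $\epsilon_0=0$, and let $x_0$ be a given real random variable independent of $\epsilon$. Consider the scalar system $$x_{k+1}=\bar a_k x_k+\sum_{i\in\mathcal I}\bar b_{ik}u_{ik}+\epsilon_{k+1},\qquad k\in\{0,\dots,N-1\},$$ in which each agent $i\in\mathcal I$ chooses $(u_{ik})_{k=0}^{N-1}$ in order to minimize the expected value of $$L_i(x_0,u)=q_{iN}\,\mathrm{var}(x_N)+\bar q_{iN}\bar x_N^{2p}+\sum_{k=0}^{N-1}\left(q_{ik}\,\mathrm{var}(x_k)+\bar q_{ik}\bar x_k^{2p}+r_{ik}\,\mathrm{var}(u_{ik})+\bar r_{ik}\bar u_{ik}^{2p}\right),$$ where $\bar x_k=\mathbb E[x_k]$ and $\bar u_{ik}=\mathbb E[u_{ik}]$. Then the (state-and-mean-field-type feedback Nash) equilibrium strategy of the game is $$u_{ik}^*=-(\bar E_k^{-1}\bar c_k)_i\,(\bar a_k\bar x_k)-(E_k^{-1}c_k)_i\,\bar a_k(x_k-\bar x_k),\qquad i\in\mathcal I,\ k\in\{0,\dots,N-1\},$$ where $$c_{ik}=\frac{\alpha_{i,k+1}\bar b_{ik}}{r_{ik}+\alpha_{i,k+1}\bar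 b_{ik}^2},\qquad \bar c_{ik}=\frac{\left(\frac{\bar\alpha_{i,k+1}\bar b_{ik}}{\bar r_{ik}}\right)^{1/(2p-1)}}{1+\left(\frac{\bar\alpha_{i,k+1}\bar b_{ik}}{\bar r_{ik}}\right)^{1/(2p-1)}\bar b_{ik}},$$ $c_k=(c_{ik})_{i\in\mathcal I}$, $\bar c_k=(\bar c_{ik})_{i\in\mathcal I}$, $E_k,\bar E_k$ are the $I\times I$ matrices with $e_{ii,k}=\bar e_{ii,k}=1$ and, for $j\neq i$, $e_{ij,k}=c_{ik}\bar b_{jk}$, $\bar e_{ij,k}=\bar c_{ik}\bar b_{jk}$, and the coefficients satisfy the recursive equations, for $k=N-1,\dots,0$, $$\bar\alpha_{ik}=\bar q_{ik}+\bar r_{ik}\left((\bar E_k^{-1}\bar c_k)_i\,\bar a_k\right)^{2p}+\bar\alpha_{i,k+1}\left(\bar a_k-\sum_{j\in\mathcal I}(\bar E_k^{-1}\bar c_k)_j\,\bar a_k\bar b_{jk}\right)^{2p},$$ $$\bar\gamma_{ik}=\bar\gamma_{i,k+1}+\alpha_{i,k+1}\mathbb E\left(\epsilon_{k+1}^2\right),$$ $$\alpha_{ik}=q_{ik}+r_{ik}\left((E_k^{-1}c_k)_i\,\bar a_k\right)^2+\alpha_{i,k+1}\left(\bar a_k-\sum_{j\in\mathcal I}(E_k^{-1}c_k)_j\,\bar a_k\bar b_{jk}\right)^2,$$ with terminal conditions $\bar\alpha_{iN}=\bar q_{iN}$, $\bar\gamma_{iN}=0$, $\alpha_{iN}=q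_{iN}$.
   Context: $(2p-1)$-th roots are real (odd) roots; $\mathrm{var}$ denotes variance. The control set of each agent at each step is $\mathbb R$; a strategy of agent $i$ is a sequence $(u_{ik})_{k=0}^{N-1}$ of Lebesgue measurable state-and-mean-field-type feedback maps, $u_{ik}=u_{ik}(x_k,\bar x_k)\in\mathbb R$. A profile $(u_i^* )_{i\in\mathcal I}$ of such strategies is a state-and-mean-field-type feedback Nash equilibrium if, for every $i\in\mathcal I$, when all agents $j\neq i$ use the feedback strategies $u_j^*$, the strategy $u_i^*$ minimizes $\mathbb E[L_i(x_0,u)]$ over all strategies of agent $i$.
   Formalization: ''Zero-mean process'' is strengthened to: each noise term also has zero mean given the earlier noise (with merely centered noise the claim is false, e.g. ε_1=ε_2=±1); strategies must in addition make each control measurable with respect to the current state x_k. *)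

(* Defs.v *)
From HB Require Import structures.
From mathcomp Require Import all_boot all_order all_algebra.
From mathcomp Require Import all_classical all_reals all_analysis.
From mathcomp Require Import measurable_realfun.

Set Implicit Arguments.
Unset Strict Implicit.
Unset Printing Implicit Defensive.

Import Order.TTheory GRing.Theory Num.Theory.
Import numFieldNormedType.Exports.

Local Open Scope classical_set_scope.
Local Open Scope ring_scope.

(* The real m-th root of any real y, intended for odd m; see odd_rootK. *)
Definition odd_root (R : realType) (m : nat) (y : R) : R :=
  Num.sg y * `|y| `^ m%:R^-1.

Lemma odd_rootK (R : realType) (m : nat) (y : R) :
  odd m -> odd_root m y ^+ m = y.
Proof.
move=> om; have m0 : (m != 0)%N by case: m om.
have sg_om : Num.sg y ^+ m = Num.sg y.
  rewrite -(odd_double_half m) om exprS -mul2n exprM sqr_sg.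
  by case: (eqVneq y 0) => [->|_]; rewrite ?sgr0 ?mul0r// expr1n mulr1.
rewrite /odd_root exprMn sg_om -[X in _ * X]powR_mulrn ?powR_ge0//.
by rewrite -powRrM mulVf ?pnatr_eq0// powRr1// -numEsg.
Qed.

Definition coupling_mx (R : realType) (n : nat) (c b : 'I_n -> R) : 'M[R]_n :=
  \matrix_(i, j) (if i == j then 1 else c i * b j).

Definition gain (R : realType) (n : nat) (c b : 'I_n -> R) (i : 'I_n) : R :=
  (invmx (coupling_mx c b) *m \col_j c j) i 0.

Section Noise.
Context {d : measure_display} {T : measurableType d} {R : realType}.
Variable P : probability T R.

Definition sigma_process (J : set nat) (eps : nat -> {RV P >-> R}) :
    set_system T :=
  <<s \bigcup_(j in J) g_sigma_algebra_preimage (eps j) >>.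

Definition independent_of_process (X : {RV P >-> R})
    (eps : nat -> {RV P >-> R}) : Prop :=
  forall A B, g_sigma_algebra_preimage X A -> sigma_process setT eps B ->
    P (A `&` B) = (P A * P B)%E.

(* E[eps_{k+1} | eps_0, ..., eps_k] = 0.  It holds in particular whenever the
   eps_k are centered and mutually independent. *)
Definition centered_given_past (eps : nat -> {RV P >-> R}) : Prop :=
  forall k A, sigma_process `I_k.+1 eps A ->
    (\int[P]_(w in A) (eps k.+1 w)%:E = 0)%E.

End Noise.

(* u k x m is the control at step k in state x with mean state m; only the
   steps k < N matter. *)
Definition strategy (R : realType) := nat -> R -> R -> R.

Definition lebesgue_measurable2 (R : realType) (f : R -> R -> R) : Prop :=
  forall B : set R, measurable B ->
    completed_algebra_gen ((@lebesgue_measure R) \x (@lebesgue_measure R))%E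
      [set z | B (f z.1 z.2)].

Definition deviate (R : realType) (n : nat) (u : 'I_n -> strategy R)
    (i : 'I_n) (v : strategy R) : 'I_n -> strategy R :=
  fun j => if j == i then v else u j.

Section Game.
Context {d : measure_display} {T : measurableType d} {R : realType}.
Variables (P : probability T R) (n N p : nat).
Variables (a : nat -> R) (b : 'I_n -> nat -> R).
(* q i N and qb i N are the terminal weights. *)
Variables (q qb r rb : 'I_n -> nat -> R).
Variables (x0 : {RV P >-> R}) (eps : nat -> {RV P >-> R}).

Fixpoint state (u : 'I_n -> strategy R) (k : nat) : T -> R :=
  if k is k'.+1 then
    let x := state u k' in let xb := fine ('E_P[x])%E in
    fun w => a k' * x w + \sum_(i < n) b i k' * u i k' (x w) xb + eps k'.+1 w
  else x0.

Definition mean_state u k : R := fine ('E_P[state u k])%E.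

Definition control u i k : T -> R :=
  fun w => u i k (state u k w) (mean_state u k).

Definition mean_control u i k : R := fine ('E_P[control u i k])%E.

(* The cost is +oo when a state or a control with a positive weight is not
   square integrable: its variance is then +oo. *)
Definition cost u i : \bar R :=
  ((q i N)%:E * 'V_P[state u N] + (qb i N * mean_state u N ^+ (2 * p))%:E
   + \sum_(0 <= k < N)
       ((q i k)%:E * 'V_P[state u k] + (qb i k * mean_state u k ^+ (2 * p))%:E
        + (r i k)%:E * 'V_P[control u i k]
        + (rb i k * mean_control u i k ^+ (2 * p))%:E))%E.

Definition expected_cost u i : \bar R := (\int[P]_w cost u i)%E.

(* Composing a Lebesgue measurable map with a random variable need not yield a
   random variable; the second condition, automatic for Borel maps, requires
   each control to be one, and to be a function of the current state only in the
   measurable sense. *)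
Definition admissible (u : 'I_n -> strategy R) : Prop :=
  forall i k, (k < N)%N ->
    lebesgue_measurable2 (u i k) /\
    (forall B, measurable B ->
       g_sigma_algebra_preimage (state u k) (control u i k @^-1` B)).

Definition nash_equilibrium (u : 'I_n -> strategy R) : Prop :=
  admissible u /\
  forall i v, admissible (deviate u i v) ->
    (expected_cost u i <= expected_cost (deviate u i v) i)%E.

Lemma borel_admissible (u : 'I_n -> strategy R) :
  (forall i k, (k < N)%N ->
     measurable_fun [set: R * R] (fun z : R * R => u i k z.1 z.2)) ->
  admissible u.
Proof.
move=> mu i k kN; split=> B mB.
  exists ((fun z : R * R => u i k z.1 z.2) @^-1` B).
    by rewrite -[X in measurable X]setTI; exact: mu.
  by exists set0; [exact: negligible_set0|rewrite setU0].
exists ((fun x => u i k x (mean_state u k)) @^-1` B); last by rewrite setTI.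
rewrite -[X in measurable X]setTI.
have -> : (fun x => u i k x (mean_state u k)) =
  (fun z : R * R => u i k z.1 z.2) \o (fun x => (x, mean_state u k)) by [].
exact: (measurableT_comp (mu i k kN) (pair2_measurable _)).
Qed.

End Game.

(* Main.v *)
Require Import Defs.
From HB Require Import structures.
From mathcomp Require Import all_boot all_order all_algebra.
From mathcomp Require Import all_classical all_reals all_analysis.
From mathcomp Require Import measurable_realfun.
From mathcomp Require Import ring lra.
Import Order.TTheory GRing.Theory Num.Theory.
Import numFieldNormedType.Exports.
Local Open Scope classical_set_scope.
Local Open Scope ring_scope.

(** A single agent, facing the linear feedbacks of the others, controls two
    decoupled quantities.  Split the state into its mean m and its fluctuation.
    The mean follows a deterministic recursion m' = Mb m + b ub, where ub is the
    mean of the control, while the variance follows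
      V' = M^2 V + 2 M b K + b^2 W + E[eps'^2],
    where W is the variance of the control, K its covariance with the state, and
    M, Mb are the factors left once the others' feedbacks are substituted
    ([mean_stateS], [variance_stateS]).  The last formula has no cross term with
    the noise: the state and the controls are functions of x0, eps_0, ..., eps_k,
    and eps_{k+1} is orthogonal to all square-integrable functions of those
    ([covariance_noise]).

    The costs split in the same way, and at each step both parts have an explicit
    minimum.  In the variance part one completes a square
    ([variance_cost_square]); the minimum is attained when the control fluctuates
    like - c M (x - m).  In the mean part, r u^2p + al (M m + b u)^2p is convex,
    so it suffices that the derivative vanishes at u = - cb M m; taking the
    (2p-1)-th root of that stationarity equation gives cb
    ([mean_cost_ge]).  Hence the function
      value_k = alpha_k V_k + alphab_k m_k^2p + gammab_k
    satisfies loss_k + value_{k+1} = value_k + (nonnegative regret), with zero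
    regret for the announced feedback ([bellman]).  Summing over k, every strategy
    of the agent costs at least value_0, and the announced one costs exactly
    value_0, which depends on x0 but not on the controls.

    It remains to see that the announced gains of all agents are best replies to
    one another.  The system E G = c reads
      G_i = c_i (1 - sum over j != i of b_j G_j),
    which is this best-reply condition; E is invertible since 0 <= c_i b_i < 1
    ([coupling_mx_unit]).

    Infinite costs are harmless: a deviation of finite cost makes every state,
    x0 included, and every control of the deviating agent square-integrable
    ([finite_cost_Lfun2]), and then the equilibrium cost is finite as well
    ([linear_Lfun2]). *)

(** * Gains and one-step minimization *)

Section Algebra.
Context {R : realType}.

(** The coupling matrix is diag(1 - c_i b_i) + c b^T, so a left kernel vector v is
    determined by s = sum_i v_i c_i, and substituting back gives
    s (1 + sum_j c_j b_j / (1 - c_j b_j)) = 0 with a positive factor. *)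
Lemma coupling_mx_unit (n : nat) (c b : 'I_n -> R) :
  (forall i, 0 <= c i * b i < 1) -> coupling_mx c b \in unitmx.
Proof.
move=> cb01; rewrite unitmxE unitfE; apply/negP => /det0P[v v0 vE].
pose s := \sum_i v 0 i * c i.
have vs j : v 0 j = - (b j * s) / (1 - c j * b j).
  have d0 : 1 - c j * b j != 0 by have /andP[_ ?] := cb01 j; rewrite subr_eq0 gt_eqF.
  apply: (mulIf d0); rewrite divfK//.
  have := congr1 (fun A : 'rV_n => A 0 j) vE; rewrite !mxE (bigD1 j)//=.
  rewrite !mxE eqxx mulr1 (eq_bigr (fun i => v 0 i * c i * b j)); last first.
    by move=> i /negPf ij; rewrite mxE ij mulrA.
  rewrite -mulr_suml => h.
  have : s = v 0 j * c j + \sum_(i < n | i != j) v 0 i * c i.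
    by rewrite /s (bigD1 j).
  rewrite addrC => /eqP; rewrite -subr_eq => /eqP hs; rewrite -hs in h.
  by rewrite -[RHS]addr0 -[X in _ = _ + X]h; ring.
have s0 : s = 0.
  have : s * (1 + \sum_j c j * b j / (1 - c j * b j)) = 0.
    rewrite mulrDr mulr1 mulr_sumr {1}/s -big_split/= big1// => j _.
    by rewrite vs; lra.
  move/eqP; rewrite mulf_eq0 => /orP[/eqP//|/eqP h].
  suff : 0 < 1 + \sum_j c j * b j / (1 - c j * b j) by rewrite h ltxx.
  apply: ltr_pwDl => //; apply: sumr_ge0 => j _; have /andP[? ?] := cb01 j.
  by rewrite divr_ge0// subr_ge0 ltW.
move/negP: v0; apply; apply/eqP/rowP => j.
by rewrite vs s0 mulr0 oppr0 mul0r mxE.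
Qed.

(** The fixed-point form of the gains: each one is the reply to the others. *)
Lemma gainE (n : nat) (c b : 'I_n -> R) (i : 'I_n) :
  (forall j, 0 <= c j * b j < 1) ->
  gain c b i = c i * (1 - \sum_(j < n | j != i) b j * gain c b j).
Proof.
move=> /coupling_mx_unit U.
have := mulKVmx U (\col_j c j) => /(congr1 (fun A : 'cV_n => A i 0)).
rewrite !mxE (bigD1 i)//= mxE eqxx mul1r -/(gain c b i) => h.
apply/eqP; rewrite mulrBr mulr1 -{1}h mulr_sumr eq_sym subr_eq; apply/eqP.
congr (_ + _); apply: eq_bigr => j /negPf ij.
by rewrite mxE eq_sym ij mulrA.
Qed.

(** Convexity of x^2p, in the form needed for minimization: the graph lies above
    its tangents. *)
Lemma even_power_tangent (p : nat) (x y : R) : (0 < p)%N ->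
  y ^+ (2 * p) + (2 * p)%:R * y ^+ (2 * p - 1) * (x - y) <= x ^+ (2 * p).
Proof.
case: p => // p _.
have -> : (2 * p.+1 - 1 = (2 * p).+1)%N by rewrite mulnS add2n subn1.
rewrite -subr_ge0; elim: p => [|p IH].
  by rewrite muln1 muln0 expr1; have := sqr_ge0 (x - y); lra.
have ev (z : R) : 0 <= z ^+ (2 * p.+1) by rewrite exprM exprn_ge0// sqr_ge0.
have mono : 0 <= (x ^+ (2 * p.+1) - y ^+ (2 * p.+1)) * (x ^+ 2 - y ^+ 2).
  rewrite !exprM subrXX mulrAC mulr_ge0//.
    by rewrite -expr2 sqr_ge0.
  by apply: sumr_ge0 => i _; rewrite mulr_ge0// exprn_ge0// sqr_ge0.
have sq := mulr_ge0 (ev y) (sqr_ge0 (x - y)).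
(* With D_p the nonnegative gap at exponent 2 p, the gap at exponent 2 p + 2 is
   y^2 D_p + (x^2p - y^2p) (x^2 - y^2) + y^2p (x - y)^2. *)
move: (addr_ge0 (mulr_ge0 (sqr_ge0 y) IH) (addr_ge0 mono sq)).
congr (0 <= _).
have E z : z ^+ (2 * p.+2) = z ^+ 2 * z ^+ (2 * p.+1) by rewrite -exprD -mulnS.
have yE : y ^+ (2 * p.+1) = y * y ^+ (2 * p).+1 by rewrite -exprS mulnS.
have -> : y ^+ (2 * p.+1).+1 = y ^+ 2 * y ^+ (2 * p).+1.
  by rewrite exprS yE expr2 mulrA.
have -> : (2 * p.+2)%:R = 2 + (2 * p.+1)%:R :> R by rewrite -natrD -mulnS.
rewrite !E yE; ring.
Qed.

Lemma odd_root_sign (m : nat) (y b : R) : 0 <= y * b -> 0 <= odd_root m y * b.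
Proof.
move=> yb; rewrite /odd_root mulrAC mulr_ge0 ?powR_ge0//.
case: (ltrgtP y 0) => [y0|y0|->]; last by rewrite sgr0 mul0r.
- by rewrite ltr0_sg// mulN1r oppr_ge0 -(nmulr_rge0 _ y0).
- by rewrite gtr0_sg// mul1r -(pmulr_rge0 _ y0).
Qed.

Lemma mean_gain_bounds (rho b : R) : 0 <= rho * b ->
  0 <= rho / (1 + rho * b) * b < 1.
Proof.
move=> h; rewrite mulrAC divr_ge0 ?addr_ge0//=.
by rewrite ltr_pdivrMr ?mul1r ?ltrDr ?ltr_pwDl.
Qed.

Lemma variance_gain_bounds (r al b : R) : 0 < r -> 0 < al ->
  0 <= al * b / (r + al * b ^+ 2) * b < 1.
Proof.
move=> r0 al0; have h : 0 <= al * b ^+ 2 by rewrite mulr_ge0 ?sqr_ge0// ltW.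
have -> : al * b / (r + al * b ^+ 2) * b = al * b ^+ 2 / (r + al * b ^+ 2).
  by rewrite expr2; ring.
have d0 : 0 < r + al * b ^+ 2 by rewrite ltr_pwDl.
by rewrite divr_ge0//= ?ltr_pdivrMr ?mul1r ?ltrDr// ltW.
Qed.

(** The right-hand side is convex in u, and the left-hand side is its value at
    u = - cb M m, where it is stationary: there u = - rho y with y = M m + b u the
    next mean, and r rho^(2p-1) = al b. *)
Lemma mean_cost_ge (p : nat) (r al b M m u rho cb : R) :
  (0 < p)%N -> 0 < r -> 0 < al ->
  rho = odd_root (2 * p - 1) (al * b / r) -> cb = rho / (1 + rho * b) ->
  (r * (cb * M) ^+ (2 * p) + al * (M - b * (cb * M)) ^+ (2 * p)) * m ^+ (2 * p)
  <= r * u ^+ (2 * p) + al * (M * m + b * u) ^+ (2 * p).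
Proof.
move=> p0 r0 al0 rhoE cbE.
have rb0 : 0 <= rho * b.
  rewrite rhoE; apply: odd_root_sign.
  rewrite mulrAC; apply: divr_ge0 (ltW r0).
  by rewrite -mulrA -expr2 mulr_ge0 ?sqr_ge0 ?(ltW al0).
have d0 : 1 + rho * b != 0 by rewrite gt_eqF// ltr_pwDl.
have rhoK : r * rho ^+ (2 * p - 1) = al * b.
  rewrite rhoE odd_rootK; first by rewrite mulrC divfK ?gt_eqF.
  by rewrite oddB ?muln_gt0// oddM.
pose us := - (cb * M * m); pose ys := M * m + b * us.
have usE : us = - (rho * ys).
  by rewrite /ys /us cbE; field.
(* Adding r times the tangent at us to al times the tangent at ys, the linear
   terms cancel by stationarity. *)
have T1 := even_power_tangent p u us p0.
have T2 := even_power_tangent p (M * m + b * u) ys p0.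
have foc : r * us ^+ (2 * p - 1) + al * b * ys ^+ (2 * p - 1) = 0.
  rewrite usE exprNn exprMn -rhoK -signr_odd oddB ?muln_gt0// oddM/= expr1; ring.
have {}T1 := ler_wpM2l (ltW r0) T1; have {}T2 := ler_wpM2l (ltW al0) T2.
apply: le_trans (lerD T1 T2).
have -> : M * m + b * u - ys = b * (u - us) by rewrite /ys; ring.
have -> : (r * (cb * M) ^+ (2 * p) + al * (M - b * (cb * M)) ^+ (2 * p))
    * m ^+ (2 * p) =
  r * us ^+ (2 * p) + al * ys ^+ (2 * p).
  have -> : us ^+ (2 * p) = (cb * M * m) ^+ (2 * p).
    by rewrite /us exprNn -signr_odd oddM/= expr0 mul1r.
  have -> : ys = (M - b * (cb * M)) * m by rewrite /ys /us; ring.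
  by rewrite mulrDl -!mulrA -!exprMn -!mulrA.
rewrite le_eqVlt; apply/orP; left; apply/eqP.
have := congr1 (fun z => (2 * p)%:R * (u - us) * z) foc; rewrite mulr0 => foc'.
apply/eqP; rewrite eq_sym -subr_eq0; apply/eqP; rewrite -[RHS]foc'.
move: ((2 * p)%:R) => k; set e := (2 * p - 1)%N; set f := (2 * p)%N.
set A := us ^+ f; set B := ys ^+ f; set C := us ^+ e; set D := ys ^+ e.
ring.
Qed.

(** Completion of the square: V, W and K stand for the variances of the state and
    of the control and for their covariance, so the bracket multiplying
    r + al b^2 is the variance of the control plus c M times the state. *)
Lemma variance_cost_square (r al b M V W K c : R) : 0 < r -> 0 < al ->
  c = al * b / (r + al * b ^+ 2) ->
  r * W + al * (M ^+ 2 * V + b ^+ 2 * W + 2 * (M * (b * K))) =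
  (r + al * b ^+ 2) * ((c * M) ^+ 2 * V + W + 2 * (c * M * K))
  + (r * (c * M) ^+ 2 + al * (M - b * (c * M)) ^+ 2) * V.
Proof.
move=> r0 al0 ->.
have d0 : r + al * b ^+ 2 != 0.
  by rewrite gt_eqF// ltr_pwDl// mulr_ge0 ?sqr_ge0// ltW.
by field.
Qed.

End Algebra.

(** * Orthogonality from vanishing integrals on level sets *)

Section Orthogonality.
Context {d : measure_display} {T : measurableType d} {R : realType}.
Local Open Scope ereal_scope.

(** The integer values of the floor are encoded in nat by [pickle], so that the
    cells form a sequence. *)
Lemma measurable_floor_code (e : R) (m : nat) : (0 < e)%R ->
  measurable [set x : R | pickle (Num.floor (x / e)) = m].
Proof.
move=> e0; have [[z zm]|nz] := pselect (exists z : int, pickle z = m).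
  rewrite (_ : [set _ | _] = `[(z%:~R * e)%R, ((z + 1)%:~R * e)%R[%classic).
    exact: measurable_itv.
  apply/seteqP; split => x /=.
    rewrite -zm => /(pcan_inj pickleK) <-; rewrite in_itv/=.
    by rewrite -ler_pdivlMr// -ltr_pdivrMr// floor_le_tmp floorD1_gt.
  rewrite in_itv/= -ler_pdivlMr// -ltr_pdivrMr// -zm => xz.
  by congr pickle; exact: floor_def.
rewrite (_ : [set _ | _] = set0)//; apply/seteqP; split => x //= xm.
by apply: nz; eexists; exact: xm.
Qed.

(** Round Z down to the grid of step e.  The rounded function is constant on
    countably many level sets of Z, so its product with X integrates to 0, and the
    rounding changes the integral by at most e times that of |X|. *)
Lemma integral_mul_eq0 (mu : {measure set T -> \bar R}) (X Z : T -> R) :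
  mu.-integrable setT (EFin \o X) -> measurable_fun setT Z ->
  mu.-integrable setT (EFin \o (X \* Z)%R) ->
  (forall C, measurable C -> \int[mu]_(w in Z @^-1` C) (X w)%:E = 0) ->
  \int[mu]_w (X w * Z w)%:E = 0.
Proof.
move=> iX mZ iXZ X0.
have mX : measurable_fun setT X by apply/measurable_EFinP; case/integrableP: iX.
suff bound e : (0 < e)%R ->
    `|\int[mu]_w (X w * Z w)%:E| <= e%:E * \int[mu]_w `|(X w)%:E|.
  have tfin := integrable_fin_num measurableT iXZ.
  have mfin := integrable_fin_num measurableT (integrable_abse iX).
  rewrite -(fineK tfin); congr EFin; apply/eqP; rewrite -normr_le0.
  have m0 : (0 <= fine (\int[mu]_w `|(X w)%:E|))%R.
    by apply: fine_ge0; exact: integral_ge0.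
  have : forall e, (0 < e)%R -> (`|fine (\int[mu]_w (X w * Z w)%:E)| <=
      e * fine (\int[mu]_w `|(X w)%:E|))%R.
    by move=> e e0; rewrite -lee_fin EFinM -abse_EFin !fineK//; exact: bound.
  move: m0 (normr_ge0 (fine (\int[mu]_w (X w * Z w)%:E))).
  set t := `|fine _|%R; set m := fine _ => m0 t0 tm.
  rewrite leNgt; apply/negP => t1.
  have m1 : (0 < m + 1)%R by lra.
  have := tm (t / (m + 1))%R (divr_gt0 t1 m1).
  rewrite mulrAC ler_pdivlMr// mulrDr mulr1 => ?; lra.
move=> e0; pose Ze w : R := ((Num.floor (Z w / e))%:~R * e)%R.
pose F m := Z @^-1` [set x : R | pickle (Num.floor (x / e)) = m].
have mF m : measurable (F m).
  by rewrite -[F m]setTI; apply: mZ => //; exact: measurable_floor_code.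
have FU : \bigcup_m F m = setT.
  by apply/seteqP; split => // w _; exists (pickle (Num.floor (Z w / e))).
have tF : trivIset setT F.
  apply/trivIsetP => i j _ _ ij; apply/seteqP; split => // w [/= hi hj].
  by rewrite -hi -hj eqxx in ij.
(* the value of Ze on the m-th cell, junk when the cell is empty *)
pose z m : R := ((odflt 0%Z (unpickle m : option int))%:~R * e)%R.
have ZeF m w : F m w -> Ze w = z m by move=> <-; rewrite /z pickleK.
have mZe : measurable_fun setT Ze.
  rewrite -FU; apply/measurable_fun_bigcup => // m.
  apply: (eq_measurable_fun (cst (z m))); last exact: measurable_cst.
  by move=> w; rewrite inE => /ZeF ->.
have ZZe w : (`|Z w - Ze w| <= e)%R.
  rewrite /Ze ger0_norm; last by rewrite subr_ge0 -ler_pdivlMr// floor_le_tmp.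
  have := floorD1_gt (Z w / e); rewrite ltr_pdivrMr// intrD mulrDl mul1r => ?.
  by rewrite lerBlDl ltW.
have XZZe w : `|(X w * (Z w - Ze w))%:E| <= e%:E * `|(X w)%:E|.
  by rewrite !abse_EFin -EFinM lee_fin normrM mulrC ler_wpM2r.
have iXd : mu.-integrable setT (EFin \o (fun w => X w * (Z w - Ze w))%R).
  apply: (le_integrable measurableT _ _
    (integrableZl measurableT e (integrable_abse iX))).
    apply/measurable_EFinP; apply: measurable_funM => //.
    exact: measurable_funB.
  by move=> w _; exact: le_trans (XZZe w) (lee_abs _).
have iXZe : mu.-integrable setT (EFin \o (X \* Ze)%R).
  have := integrableB measurableT iXZ iXd; apply: eq_integrable => // w _ /=.
  by rewrite -EFinB; congr EFin; ring.
have int0 : \int[mu]_w (X w * Ze w)%:E = 0.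
  rewrite -FU integral_bigcup//; last by rewrite FU.
  apply: eseries0 => m _ _.
  transitivity (\int[mu]_(w in F m) ((z m)%:E * (X w)%:E)).
    by apply: eq_integral => w; rewrite inE => /ZeF ->; rewrite -EFinM mulrC.
  rewrite integralZl//; last exact: integrableS iX.
  by rewrite X0 ?mule0//; exact: measurable_floor_code.
have -> : \int[mu]_w (X w * Z w)%:E = \int[mu]_w (X w * (Z w - Ze w))%:E.
  rewrite -[LHS]sube0 -int0 -integralB_EFin//.
  by apply: eq_integral => w _; rewrite -EFinB mulrBr.
apply: (le_trans (le_abse_integral _ _ _)) => //; first by case/integrableP: iXd.
rewrite -ge0_integralZl//; last 2 first.
- by apply: measurableT_comp => //; exact/measurable_EFinP.
- by rewrite lee_fin ltW.
apply: ge0_le_integral => //.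
- by apply: measurableT_comp => //; case/integrableP: iXd.
- apply: emeasurable_funM => //.
  by apply: measurableT_comp => //; exact/measurable_EFinP.
Qed.

End Orthogonality.

(** * The noise is orthogonal to the past *)

Section Filtration.
Context {d : measure_display} {T : measurableType d} {R : realType}.
Variables (P : probability T R) (x0 : {RV P >-> R}) (eps : nat -> {RV P >-> R}).

(** These sets generate the sigma-algebra of x0, eps_0, ..., eps_k; unlike the
    union of the two sigma-algebras, they are stable under intersection. *)
Definition past_rect (k : nat) : set_system T :=
  [set C | exists A B, [/\ g_sigma_algebra_preimage x0 A,
     sigma_process `I_k.+1 eps B & C = A `&` B]].

Definition past (k : nat) : set_system T := <<s past_rect k >>.

Definition past_measurable (k : nat) (Z : T -> R) : Prop :=
  measurable_fun [set: g_sigma_algebraType (past_rect k)] Z.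

Lemma preimage_algebra_sub (X : {RV P >-> R}) :
  g_sigma_algebra_preimage X `<=` measurable.
Proof.
by move=> _ [B mB <-]; exact: (measurable_funP X).
Qed.

Lemma sigma_process_sub J : sigma_process J eps `<=` measurable.
Proof.
apply: smallest_sub; first exact: sigma_algebra_measurable.
by move=> A [j _]; exact: preimage_algebra_sub.
Qed.

Lemma past_sub k : past k `<=` measurable.
Proof.
apply: smallest_sub; first exact: sigma_algebra_measurable.
move=> _ [A [B [/preimage_algebra_sub mA /sigma_process_sub mB ->]]].
exact: measurableI.
Qed.

Lemma past_rectI k : setI_closed (past_rect k).
Proof.
move=> _ _ [A [B [mA mB ->]]] [A' [B' [mA' mB' ->]]].
exists (A `&` A'), (B `&` B'); split; last by rewrite setIACA.
- exact: (@measurableI _ (g_sigma_algebra_preimageType x0)).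
- exact: (@measurableI _ (g_sigma_algebraType
    (\bigcup_(j in `I_k.+1) g_sigma_algebra_preimage (eps j)))).
Qed.

Lemma past_measurableW k Z : past_measurable k Z -> measurable_fun setT Z.
Proof. by move=> mZ _ B mB; apply: past_sub; exact: mZ. Qed.

Lemma past_measurableS k Z : past_measurable k Z -> past_measurable k.+1 Z.
Proof.
move=> mZ _ B mB; apply: sub_sigma_algebra2 (mZ measurableT B mB).
move=> _ [A [C [mA mC ->]]]; exists A, C; split => //.
apply: sub_sigma_algebra2 mC => D [j jk mD]; exists j => //=.
exact: ltn_trans jk _.
Qed.

Lemma past_measurable_x0 k : past_measurable k x0.
Proof.
move=> _ B mB; apply: sub_sigma_algebra; exists (x0 @^-1` B), setT.
split; last by rewrite setTI setIT.
- by exists B => //; rewrite setTI.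
- exact: (@measurableT _ (g_sigma_algebraType
    (\bigcup_(j in `I_k.+1) g_sigma_algebra_preimage (eps j)))).
Qed.

Lemma past_measurable_eps k : past_measurable k (eps k).
Proof.
move=> _ B mB; apply: sub_sigma_algebra; exists setT, (eps k @^-1` B).
split => //.
- exact: (@measurableT _ (g_sigma_algebra_preimageType x0)).
- by apply: sub_sigma_algebra; exists k => //=; exists B => //; rewrite setTI.
Qed.

Hypothesis hepsC : centered_given_past eps.
Hypothesis hind : independent_of_process x0 eps.
Hypothesis hepsE : forall k, ('E_P[eps k] = 0)%E.

(** On A `&` B the integral is that of 1_A Z with Z = 1_B eps_{k+1}, and Z is
    centered.  Since A is independent of the noise, 1_A - P(A) has integral 0 on
    every level set of Z, hence is orthogonal to Z. *)
Lemma integral_past_rect k C : P.-integrable setT (EFin \o eps k.+1) ->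
  past_rect k C -> (\int[P]_(w in C) (eps k.+1 w)%:E = 0)%E.
Proof.
move=> ie [A [B [mA mB ->{C}]]].
have [nA nB] := (preimage_algebra_sub _ _ mA, sigma_process_sub _ _ mB).
have mB' : sigma_process setT eps B.
  by apply: sub_sigma_algebra2 mB => D [j _ mD]; exists j.
pose X w : R := \1_A w - fine (P A).
pose Z w : R := eps k.+1 w * \1_B w.
have PAfin : P A \is a fin_num by exact: fin_num_measure.
have iX : P.-integrable setT (EFin \o X).
  have := integrableB measurableT (integrable_indic P nA)
    (finite_measure_integrable_cst P (fine (P A)) measurableT).
  by apply: eq_integrable.
have mX : measurable_fun setT X by apply/measurable_EFinP; case/integrableP: iX.
have mZ : measurable_fun setT Z.
  by apply: measurable_funM => //; exact: measurable_indic.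
have iZ : P.-integrable setT (EFin \o Z).
  apply: (le_integrable measurableT _ _ ie); first exact/measurable_EFinP.
  move=> w _ /=; rewrite lee_fin /Z normrM indicE; case: (_ \in _).
    by rewrite normr1 mulr1.
  by rewrite normr0 mulr0.
have iXZ : P.-integrable setT (EFin \o (X \* Z)).
  have := integrableZl measurableT (1 + `|fine (P A)|) iZ.
  apply: (le_integrable measurableT).
    by apply/measurable_EFinP; exact: measurable_funM.
  move=> w _ /=; rewrite lee_fin !normrM ler_wpM2r// (le_trans (ler_normB _ _))//.
  rewrite [leRHS]ger0_norm ?addr_ge0// lerD2r indicE.
  by case: (_ \in _); rewrite ?normr1 ?normr0.
have SZ C : measurable C -> sigma_process setT eps (Z @^-1` C).
  pose S := g_sigma_algebraType
    (\bigcup_(j in setT) g_sigma_algebra_preimage (eps j)).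
  have mZS : measurable_fun [set: S] (Z : S -> R).
    apply: measurable_funM; last exact: measurable_indic.
    move=> _ D mD; apply: sub_sigma_algebra; exists k.+1 => //.
    by exists D.
  by move=> mC; have := mZS measurableT C mC; rewrite setTI.
have XZ0 : (\int[P]_w (X w * Z w)%:E = 0)%E.
  apply: integral_mul_eq0 => // C mC.
  have mD : measurable (Z @^-1` C) by apply: sigma_process_sub (SZ C mC).
  rewrite (_ : (\int[P]_(w in _) _ =
     \int[P]_(w in Z @^-1` C) ((\1_A w)%:E - (fine (P A))%:E))%E); last first.
    by apply: eq_integral => w _; rewrite -EFinB.
  rewrite integralB_EFin//.
  + rewrite integral_indic// integral_cst// fineK//.
    transitivity (P A * P (Z @^-1` C) - P A * P (Z @^-1` C))%E.
      by congr (_ - _)%E; exact: hind (SZ C mC).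
    by rewrite subee// fin_numM// fin_num_measure.
  + exact: integrableS (integrable_indic P nA).
  + exact: finite_measure_integrable_cst.
have -> : (\int[P]_(w in A `&` B) (eps k.+1 w)%:E = \int[P]_w (\1_A w * Z w)%:E)%E.
  rewrite integral_mkcond; apply: eq_integral => w _.
  rewrite patchE in_setI /Z !indicE.
  by do 2 case: (_ \in _); rewrite /= ?mul0r ?mulr0 ?mulr1 ?mul1r.
have B0 : (\int[P]_w (Z w)%:E = 0)%E.
  rewrite -[RHS](hepsC _ _ mB) [RHS]integral_mkcond; apply: eq_integral => w _.
  by rewrite patchE /Z indicE; case: (_ \in _); rewrite ?mulr1 ?mulr0.
have -> : (\int[P]_w (\1_A w * Z w)%:E =
    \int[P]_w ((X w * Z w)%:E + (fine (P A))%:E * (Z w)%:E))%E.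
  by apply: eq_integral => w _; rewrite -EFinM -EFinD /X; congr EFin; ring.
rewrite integralD//; last exact: integrableZl.
by rewrite integralZl// B0 mule0 XZ0 adde0.
Qed.

(** The sets on which eps_{k+1} integrates to 0 form a Dynkin system, and the
    generators are stable under intersection. *)
Lemma integral_past k C : P.-integrable setT (EFin \o eps k.+1) ->
  past k C -> (\int[P]_(w in C) (eps k.+1 w)%:E = 0)%E.
Proof.
move=> ie; rewrite /past -(setI_closed_g_dynkin_g_sigma_algebra (past_rectI k)).
move=> kC; suff: [set C | measurable C /\
    (\int[P]_(w in C) (eps k.+1 w)%:E = 0)%E] C by case.
apply: kC; split; last first.
  move=> D mD; split; last exact: integral_past_rect mD.
  by apply: (past_sub k); rewrite /past; exact: sub_sigma_algebra.
split => [|D [mD D0]|F tF hF].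
- by split => //; have := hepsE k.+1; rewrite unlock.
- split; first exact: measurableC.
  have := hepsE k.+1; rewrite unlock -(setUv D) integral_setU//.
  + by rewrite D0 add0e.
  + exact: measurableC.
  + by apply: measurable_funTS; case/integrableP: ie.
  + by apply/disj_setPS => w [].
- have mF i : measurable (F i) by have [] := hF i.
  split; first exact: bigcup_measurable.
  rewrite integral_bigcup//.
    by apply: eseries0 => i _ _; have [] := hF i.
  by apply: integrableS ie => //; exact: bigcup_measurable.
Qed.

Lemma covariance_noise k Z : past_measurable k Z -> Z \in Lfun P 2%:E ->
  (eps k.+1 : T -> R) \in Lfun P 2%:E -> covariance P (eps k.+1) Z = 0.
Proof.
move=> mZ Z2 e2.
have Pfin : P setT \is a fin_num := fin_num_measure P _ measurableT.
have e1 := Lfun_subset12 Pfin e2; have Z1 := Lfun_subset12 Pfin Z2.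
have eZ := Lfun2_mul_Lfun1 e2 Z2.
rewrite covarianceE// hepsE mul0e sube0 unlock.
apply: integral_mul_eq0.
- exact/Lfun1_integrable.
- exact: past_measurableW mZ.
- exact/Lfun1_integrable.
- move=> C mC; apply: integral_past; first exact/Lfun1_integrable.
  by have := mZ measurableT C mC; rewrite setTI.
Qed.

End Filtration.

(** * Square-integrable functions *)

Section SquareIntegrable.
Context {d : measure_display} {T : measurableType d} {R : realType}.
Variable P : probability T R.

Lemma Lfun2_of_sqr (X : T -> R) : measurable_fun setT X ->
  (\int[P]_w (X w ^+ 2)%:E < +oo)%E -> X \in Lfun P 2%:E.
Proof.
move=> mX X2; rewrite inE; apply/andP; split; rewrite inE//=.
rewrite /finite_norm; apply: (@lty_poweRy _ _ 2) => //.
rewrite poweR_Lnorm//; apply: le_lt_trans X2.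
rewrite le_eqVlt; apply/orP; left; apply/eqP; apply: eq_integral => w _.
by rewrite /= powR_mulrn// real_normK// num_real.
Qed.

Lemma Lfun2_of_variance (X : T -> R) : measurable_fun setT X ->
  ('V_P[X] < +oo)%E -> X \in Lfun P 2%:E.
Proof.
move=> mX; rewrite /variance unlock unlock => VX.
set m := fine _ in VX.
have Xm : (X \- cst m) \in Lfun P 2%:E.
  by apply: Lfun2_of_sqr => //; exact: measurable_funB.
have -> : X = (X \- cst m) \+ cst m by apply/funext => w /=; rewrite subrK.
by rewrite rpredD//= ?lee1n// Lfun_cst.
Qed.

Lemma Lfun2_lin (x y : R) (X Y : T -> R) :
  X \in Lfun P 2%:E -> Y \in Lfun P 2%:E ->
  (fun w => x * X w + y * Y w) \in Lfun P 2%:E.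
Proof.
move=> X2 Y2; have -> : (fun w => x * X w + y * Y w) = (x \o* X) \+ (y \o* Y).
  by apply/funext => w /=; rewrite mulrC (mulrC y).
by rewrite rpredD//= ?lee1n// Lfun_scale// ler1n.
Qed.

Lemma mean_lin (x y : R) (X Y : T -> R) :
  X \in Lfun P 2%:E -> Y \in Lfun P 2%:E ->
  fine 'E_P[fun w => x * X w + y * Y w] = x * fine 'E_P[X] + y * fine 'E_P[Y].
Proof.
move=> X2 Y2.
have Pfin : P setT \is a fin_num := fin_num_measure P _ measurableT.
have X1 := Lfun_subset12 Pfin X2; have Y1 := Lfun_subset12 Pfin Y2.
have -> : (fun w => x * X w + y * Y w) = (x \o* X) \+ (y \o* Y).
  by apply/funext => w /=; rewrite mulrC (mulrC y).
rewrite expectationD ?Lfun_scale// !expectationZl//.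
by rewrite fineD ?fin_numM ?expectation_fin_num// !fineM ?expectation_fin_num.
Qed.

Lemma variance_lin (x y : R) (X Y : T -> R) :
  X \in Lfun P 2%:E -> Y \in Lfun P 2%:E ->
  fine 'V_P[fun w => x * X w + y * Y w] =
  x ^+ 2 * fine 'V_P[X] + y ^+ 2 * fine 'V_P[Y]
  + 2 * (x * (y * fine (covariance P X Y))).
Proof.
move=> X2 Y2.
have Pfin : P setT \is a fin_num := fin_num_measure P _ measurableT.
have X1 := Lfun_subset12 Pfin X2; have Y1 := Lfun_subset12 Pfin Y2.
have XY1 := Lfun2_mul_Lfun1 X2 Y2.
have -> : (fun w => x * X w + y * Y w) = (x \o* X) \+ (y \o* Y).
  by apply/funext => w /=; rewrite mulrC (mulrC y).
have s2 z Z : Z \in Lfun P 2%:E -> z \o* Z \in Lfun P 2%:E.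
  by move=> Z2; rewrite Lfun_scale// ler1n.
have covE : covariance P (x \o* X) (y \o* Y) =
    (x%:E * (y%:E * covariance P X Y))%E.
  rewrite covarianceZl//; first by rewrite covarianceZr.
    by rewrite Lfun_scale.
  exact: Lfun2_mul_Lfun1 (s2 _ _ Y2).
have cfin := covariance_fin_num X1 Y1 XY1.
rewrite varianceD ?s2// !varianceZ// covE.
have [Vx Vy] := (variance_fin_num X2, variance_fin_num Y2).
by rewrite !fineD ?fin_numD ?fin_numM// !fineM ?fin_numM.
Qed.

End SquareIntegrable.

(** * The game *)

Section Game.
Context {d : measure_display} {T : measurableType d} {R : realType}.
Variables (P : probability T R) (p n N : nat).
Hypothesis p_gt0 : (0 < p)%N.
Variables (a : nat -> R) (b q qb r rb : 'I_n -> nat -> R).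
Hypothesis q_gt0 : forall i k, (k <= N)%N -> 0 < q i k.
Hypothesis qb_gt0 : forall i k, (k <= N)%N -> 0 < qb i k.
Hypothesis r_gt0 : forall i k, (k < N)%N -> 0 < r i k.
Hypothesis rb_gt0 : forall i k, (k < N)%N -> 0 < rb i k.
Variables (x0 : {RV P >-> R}) (eps : nat -> {RV P >-> R}).
Hypothesis epsE : forall k, ('E_P[eps k] = 0)%E.
Hypothesis epsC : centered_given_past eps.
Hypothesis x0_ind : independent_of_process x0 eps.
Variables (c cb alpha alphab gammab : 'I_n -> nat -> R).
Hypothesis cE : forall i k, (k < N)%N ->
  c i k = alpha i k.+1 * b i k / (r i k + alpha i k.+1 * b i k ^+ 2).
Hypothesis cbE : forall i k, (k < N)%N ->
  cb i k = odd_root (2 * p - 1) (alphab i k.+1 * b i k / rb i k)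
    / (1 + odd_root (2 * p - 1) (alphab i k.+1 * b i k / rb i k) * b i k).
Hypothesis alphabN : forall i, alphab i N = qb i N.
Hypothesis gammabN : forall i, gammab i N = 0.
Hypothesis alphaN : forall i, alpha i N = q i N.

Let G i k := gain (c^~ k) (b^~ k) i.
Let Gb i k := gain (cb^~ k) (b^~ k) i.

Hypothesis alphabS : forall i k, (k < N)%N ->
  alphab i k = qb i k + rb i k * (Gb i k * a k) ^+ (2 * p)
    + alphab i k.+1 * (a k - \sum_(j < n) Gb j k * a k * b j k) ^+ (2 * p).
Hypothesis gammabS : forall i k, (k < N)%N ->
  ((gammab i k)%:E = (gammab i k.+1)%:E
    + (alpha i k.+1)%:E * 'E_P[fun w => (eps k.+1 w ^+ 2)%R])%E.
Hypothesis alphaS : forall i k, (k < N)%N ->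
  alpha i k = q i k + r i k * (G i k * a k) ^+ 2
    + alpha i k.+1 * (a k - \sum_(j < n) G j k * a k * b j k) ^+ 2.

Let ustar : 'I_n -> strategy R := fun i k x xb =>
  - Gb i k * (a k * xb) - G i k * a k * (x - xb).

Lemma even_power_ge0 (x : R) : 0 <= x ^+ (2 * p).
Proof. by rewrite exprM exprn_ge0// sqr_ge0. Qed.

Lemma alpha_gt0 i k : (k <= N)%N -> 0 < alpha i k.
Proof.
move=> /subnK; move: (N - k)%N => m; elim: m k => [k|m IH k] kE.
  by rewrite -[k]add0n kE alphaN q_gt0.
have kN : (k < N)%N by rewrite -kE addSn ltnS leq_addl.
rewrite alphaS// -addrA ltr_pwDl ?q_gt0 ?(ltnW kN)// addr_ge0//.
  by rewrite mulr_ge0 ?sqr_ge0// ltW// r_gt0.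
by rewrite mulr_ge0 ?sqr_ge0// ltW// IH// addnS -addSn.
Qed.

Lemma alphab_gt0 i k : (k <= N)%N -> 0 < alphab i k.
Proof.
move=> /subnK; move: (N - k)%N => m; elim: m k => [k|m IH k] kE.
  by rewrite -[k]add0n kE alphabN qb_gt0.
have kN : (k < N)%N by rewrite -kE addSn ltnS leq_addl.
rewrite alphabS// -addrA ltr_pwDl ?qb_gt0 ?(ltnW kN)// addr_ge0//.
  by rewrite mulr_ge0 ?even_power_ge0// ltW// rb_gt0.
by rewrite mulr_ge0 ?even_power_ge0// ltW// IH// addnS -addSn.
Qed.

(** The recursion for gammab has no solution when the second moment of the noise
    is infinite, because alpha is positive. *)
Lemma noise_Lfun2 (i : 'I_n) k : (k < N)%N -> (eps k.+1 : T -> R) \in Lfun P 2%:E.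
Proof.
move=> kN; apply: Lfun2_of_sqr => //.
have := gammabS i _ kN; rewrite unlock.
have : (0 <= \int[P]_w (eps k.+1 w ^+ 2)%:E)%E.
  by apply: integral_ge0 => w _; rewrite lee_fin sqr_ge0.
case: (integral _ _ _) => [x _ _|_|//]; first exact: ltry.
by rewrite gt0_muley// lte_fin alpha_gt0.
Qed.

(** The factors by which the other agents' feedbacks multiply the fluctuation and
    the mean of the state in one step. *)
Let M i k := a k - \sum_(j < n | j != i) b j k * (G j k * a k).
Let Mb i k := a k - \sum_(j < n | j != i) b j k * (Gb j k * a k).

Lemma gain_reply i k : (k < N)%N -> G i k * a k = c i k * M i k.
Proof.
move=> kN; rewrite {1}/G gainE => [|j].
  rewrite -mulrA /M mulrBl mul1r mulr_suml; congr (_ * (_ - _)).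
  by apply: eq_bigr => j _; rewrite mulrA.
by rewrite cE//; apply: variance_gain_bounds; rewrite ?r_gt0 ?alpha_gt0.
Qed.

Lemma mean_gain_reply i k : (k < N)%N -> Gb i k * a k = cb i k * Mb i k.
Proof.
move=> kN; rewrite {1}/Gb gainE => [|j].
  rewrite -mulrA /Mb mulrBl mul1r mulr_suml; congr (_ * (_ - _)).
  by apply: eq_bigr => j _; rewrite mulrA.
rewrite cbE//; apply: mean_gain_bounds; apply: odd_root_sign.
rewrite mulrAC; apply: divr_ge0; last by rewrite ltW// rb_gt0.
by rewrite -mulrA -expr2 mulr_ge0 ?sqr_ge0// ltW// alphab_gt0.
Qed.

Lemma closed_loop i k : (k < N)%N ->
  a k - \sum_(j < n) G j k * a k * b j k = M i k - b i k * (c i k * M i k).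
Proof.
move=> kN; rewrite (bigD1 i)//= gain_reply// {2}/M opprD addrA addrAC.
congr (_ - _); last by rewrite mulrC.
by congr (_ - _); apply: eq_bigr => j _; rewrite mulrC.
Qed.

Lemma mean_closed_loop i k : (k < N)%N ->
  a k - \sum_(j < n) Gb j k * a k * b j k = Mb i k - b i k * (cb i k * Mb i k).
Proof.
move=> kN; rewrite (bigD1 i)//= mean_gain_reply// {2}/Mb opprD addrA addrAC.
congr (_ - _); last by rewrite mulrC.
by congr (_ - _); apply: eq_bigr => j _; rewrite mulrC.
Qed.

Lemma second_moment_fin (i : 'I_n) k : (k < N)%N ->
  ('E_P[fun t => (eps k.+1 t ^+ 2)%R])%E \is a fin_num.
Proof.
move=> kN; rewrite unlock; apply: integrable_fin_num => //.
exact: Lfun2_integrable_sqr (noise_Lfun2 i k kN).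
Qed.

Local Notation st := (state a b x0 eps).
Local Notation ctl := (control a b x0 eps).
Local Notation mst := (mean_state a b x0 eps).
Local Notation mctl := (mean_control a b x0 eps).
Local Notation L2 := (Lfun P 2%:E).

(** In this section agent i plays an arbitrary admissible strategy against the
    linear feedbacks of the others. *)
Section Profile.
Variables (i : 'I_n) (u : 'I_n -> strategy R).
Hypothesis others : forall j k x xb, j != i -> u j k x xb = ustar j k x xb.
Hypothesis u_adm : admissible N a b x0 eps u.

(** The constant that the others add to the state because their feedbacks treat
    the mean and the fluctuation differently; in the mean recursion it turns M
    into Mb. *)
Let kick k : R := \sum_(j < n | j != i) b j k * (G j k * a k) * mst u k
  - \sum_(j < n | j != i) b j k * (Gb j k * a k) * mst u k.

Let input k : T -> R := fun t => M i k * st u k t + b i k * ctl u i k t.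

(** The factors 1 give the right-hand side the shape x X + y Y of [mean_lin] and
    [variance_lin]. *)
Lemma stateS k :
  st u k.+1 = (fun t => 1 * input k t + 1 * ((eps k.+1 \+ cst (kick k)) t)).
Proof.
apply/funext => t /=; rewrite (bigD1 i)//= /input /M /kick !mul1r.
rewrite (eq_bigr (fun j => b j k * (G j k * a k) * mst u k -
    b j k * (Gb j k * a k) * mst u k - b j k * (G j k * a k) * st u k t)).
  by rewrite !sumrB -!mulr_suml /control /mean_state; ring.
by move=> j ji; rewrite others// /ustar -/(mst u k); ring.
Qed.

(** Admissibility makes a control a measurable function of the current state. *)
Lemma control_past_state j k : (k < N)%N ->
  past_measurable P x0 eps k (st u k) -> past_measurable P x0 eps k (ctl u j k).
Proof.
move=> kN mS _ B mB; have [_ /(_ B mB)[D mD]] := u_adm j k kN.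
by rewrite !setTI => <-; have := mS measurableT D mD; rewrite setTI.
Qed.

Lemma state_past k : (k <= N)%N -> past_measurable P x0 eps k (st u k).
Proof.
elim: k => [_|k IH kN]; first exact: past_measurable_x0.
have mS := IH (ltnW kN); rewrite stateS.
apply: measurable_funD; apply: measurable_funM => //.
  apply: past_measurableS; apply: measurable_funD; apply: measurable_funM => //.
  exact: control_past_state.
by apply: measurable_funD => //; exact: past_measurable_eps.
Qed.

Lemma control_past j k : (k < N)%N -> past_measurable P x0 eps k (ctl u j k).
Proof.
by move=> kN; apply: control_past_state => //; exact: state_past (ltnW kN).
Qed.

Section Finite.
Hypothesis st2 : forall k, (k <= N)%N -> st u k \in L2.
Hypothesis ctl2 : forall k, (k < N)%N -> ctl u i k \in L2.

Lemma input_Lfun2 k : (k < N)%N -> input k \in L2.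
Proof. by move=> kN; rewrite Lfun2_lin ?st2 ?ctl2// ltnW. Qed.

Lemma kicked_noise_Lfun2 k : (k < N)%N -> eps k.+1 \+ cst (kick k) \in L2.
Proof.
by move=> kN; rewrite rpredD//= ?lee1n ?Lfun_cst// noise_Lfun2.
Qed.

Lemma mean_stateS k : (k < N)%N ->
  mst u k.+1 = Mb i k * mst u k + b i k * mctl u i k.
Proof.
move=> kN; have Pfin : P setT \is a fin_num := fin_num_measure P _ measurableT.
rewrite {1}/mean_state stateS mean_lin ?input_Lfun2 ?kicked_noise_Lfun2// !mul1r.
rewrite mean_lin ?st2 ?ctl2 ?(ltnW kN)// expectationD ?Lfun_cst//; last first.
  by rewrite (Lfun_subset12 Pfin)// (noise_Lfun2 i).
rewrite epsE add0e expectation_cst /= -/(mst u k) -/(mctl u i k).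
by rewrite /kick -!mulr_suml /M /Mb; ring.
Qed.

Lemma variance_stateS k : (k < N)%N ->
  fine 'V_P[st u k.+1] = M i k ^+ 2 * fine 'V_P[st u k]
    + b i k ^+ 2 * fine 'V_P[ctl u i k]
    + 2 * (M i k * (b i k * fine (covariance P (st u k) (ctl u i k))))
    + fine 'E_P[fun t => eps k.+1 t ^+ 2].
Proof.
move=> kN; have e2 := noise_Lfun2 i k kN.
rewrite stateS variance_lin ?input_Lfun2 ?kicked_noise_Lfun2// expr1n !mul1r.
rewrite variance_lin ?st2 ?ctl2 ?(ltnW kN)// varianceD_cst_r//.
rewrite covarianceDr ?Lfun_cst ?input_Lfun2// covariance_cst_r adde0.
rewrite (covarianceC P (input k)) (covariance_noise P _ _ epsC x0_ind epsE k)//=.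
- rewrite mulr0 addr0; congr (_ + _).
  by rewrite varianceE// epsE expe2 mule0 sube0.
- apply: measurable_funD.
    apply: measurable_funM => //; exact: state_past (ltnW kN).
  by apply: measurable_funM => //; exact: control_past.
- exact: input_Lfun2.
Qed.

Let loss k := q i k * fine 'V_P[st u k] + qb i k * mst u k ^+ (2 * p)
  + r i k * fine 'V_P[ctl u i k] + rb i k * mctl u i k ^+ (2 * p).

Let value k := alpha i k * fine 'V_P[st u k] + alphab i k * mst u k ^+ (2 * p)
  + gammab i k.

Let regret k := (r i k + alpha i k.+1 * b i k ^+ 2) *
    fine 'V_P[fun t => (c i k * M i k) * st u k t + 1 * ctl u i k t].

Let mean_regret k := rb i k * mctl u i k ^+ (2 * p)
   + alphab i k.+1 * (Mb i k * mst u k + b i k * mctl u i k) ^+ (2 * p)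
   - (rb i k * (cb i k * Mb i k) ^+ (2 * p)
      + alphab i k.+1 * (Mb i k - b i k * (cb i k * Mb i k)) ^+ (2 * p))
     * mst u k ^+ (2 * p).

(** The dynamic programming identity, with the loss of optimality made explicit:
    a multiple of a variance for the fluctuations and a convexity gap for the
    means. *)
Lemma bellman k : (k < N)%N ->
  loss k + value k.+1 = value k + (regret k + mean_regret k).
Proof.
move=> kN.
have gE : gammab i k = gammab i k.+1
    + alpha i k.+1 * fine 'E_P[fun t => eps k.+1 t ^+ 2].
  have := gammabS i k kN.
  rewrite -[X in (_ * X)%E]fineK ?(second_moment_fin i)//.
  by rewrite -EFinM -EFinD => -[].
rewrite /loss /value /regret /mean_regret.
rewrite variance_lin ?st2 ?ctl2 ?(ltnW kN)//.
rewrite variance_stateS// mean_stateS// (alphaS i k)// (alphabS i k)// gE.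
rewrite (closed_loop i)// (mean_closed_loop i)// gain_reply// mean_gain_reply//.
have := variance_cost_square (r i k) (alpha i k.+1) (b i k) (M i k)
  (fine 'V_P[st u k]) (fine 'V_P[ctl u i k])
  (fine (covariance P (st u k) (ctl u i k))) (c i k)
  (r_gt0 i k kN) (alpha_gt0 i k.+1 kN) (cE i k kN).
rewrite expr1n => vs; apply/eqP; rewrite eq_sym -subr_eq0; apply/eqP.
have := congr1 (fun z => z - (r i k * fine 'V_P[ctl u i k] + alpha i k.+1 *
  (M i k ^+ 2 * fine 'V_P[st u k] + b i k ^+ 2 * fine 'V_P[ctl u i k]
   + 2 * (M i k * (b i k * fine (covariance P (st u k) (ctl u i k))))))) vs.
rewrite subrr => {}vs; rewrite [RHS]vs; ring.
Qed.

Lemma regret_ge0 k : (k < N)%N -> 0 <= regret k + mean_regret k.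
Proof.
move=> kN; rewrite addr_ge0//.
  apply: mulr_ge0; last exact: fine_ge0 (variance_ge0 _ _).
  apply: addr_ge0; first exact: ltW (r_gt0 i k kN).
  by rewrite mulr_ge0 ?sqr_ge0// (ltW (alpha_gt0 i k.+1 kN)).
rewrite subr_ge0; apply: mean_cost_ge p_gt0 _ _ _ (cbE i k kN) => //.
  exact: rb_gt0.
exact: alphab_gt0.
Qed.

Lemma costE : cost N p a b q qb r rb x0 eps u i =
  (q i N * fine 'V_P[st u N] + qb i N * mst u N ^+ (2 * p)
   + \sum_(0 <= k < N) loss k)%:E.
Proof.
have stE k : (k <= N)%N -> 'V_P[st u k] = (fine 'V_P[st u k])%:E.
  by move=> kN; rewrite fineK// variance_fin_num// st2.
rewrite /cost stE// EFinD -sumEFin big_nat [in RHS]big_nat; congr (_ + _)%E.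
apply: eq_bigr => k /andP[_ kN]; rewrite stE ?(ltnW kN)//.
by rewrite -[X in (_ + _ * X + _)%E](fineK (variance_fin_num (ctl2 k kN))).
Qed.

(** Telescoping sum of the dynamic programming identity. *)
Lemma cost_value : cost N p a b q qb r rb x0 eps u i =
  (value 0 + \sum_(0 <= k < N) (regret k + mean_regret k))%:E.
Proof.
rewrite costE; congr EFin.
have -> : q i N * fine 'V_P[st u N] + qb i N * mst u N ^+ (2 * p) = value N.
  by rewrite /value alphaN alphabN gammabN addr0.
apply/eqP; rewrite -subr_eq0 opprD addrACA.
rewrite -[value N - value 0](telescope_sumr value)//.
rewrite -sumrB -big_split/= big_nat big1// => k /andP[_ kN].
by have := bellman k kN => /eqP; rewrite addrC -subr_eq0 => /eqP <-; ring.
Qed.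

Lemma value_le_cost : ((value 0)%:E <= cost N p a b q qb r rb x0 eps u i)%E.
Proof.
rewrite cost_value lee_fin lerDl big_nat sumr_ge0// => k /andP[_ kN].
exact: regret_ge0.
Qed.

(** Under the announced feedback the control plus c M times the state is constant,
    and the mean of the control is the minimizer of the mean part. *)
Lemma value_eq_cost : (forall k x xb, u i k x xb = ustar i k x xb) ->
  (value 0)%:E = cost N p a b q qb r rb x0 eps u i.
Proof.
move=> uE; rewrite cost_value big_nat big1 ?addr0// => k /andP[_ kN].
have ctlE : ctl u i k = (fun t => - (c i k * M i k) * st u k t
   + 1 * cst ((c i k * M i k - cb i k * Mb i k) * mst u k) t).
  apply/funext => t; rewrite /control uE /ustar -gain_reply// -mean_gain_reply//.
  by rewrite /=; ring.
have mctlE : mctl u i k = - (cb i k * Mb i k * mst u k).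
  rewrite /mean_control ctlE mean_lin ?st2 ?(ltnW kN) ?Lfun_cst//.
  by rewrite expectation_cst/= -/(mst u k); ring.
have -> : regret k = 0.
  rewrite /regret (_ : (fun t => _) =
      cst ((c i k * M i k - cb i k * Mb i k) * mst u k)).
    by rewrite variance_cst mulr0.
  by apply/funext => t; rewrite ctlE/=; ring.
rewrite add0r /mean_regret mctlE.
have -> : Mb i k * mst u k + b i k * - (cb i k * Mb i k * mst u k) =
  (Mb i k - b i k * (cb i k * Mb i k)) * mst u k by ring.
rewrite exprNn -signr_odd oddM/= expr0 mul1r !exprMn; ring.
Qed.

End Finite.

(** All summands of the cost are nonnegative and all weights are positive, so no
    variance can be infinite. *)
Lemma finite_cost_Lfun2 : (cost N p a b q qb r rb x0 eps u i < +oo)%E ->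
  (forall k, (k <= N)%N -> st u k \in L2) /\
  (forall k, (k < N)%N -> ctl u i k \in L2).
Proof.
pose term k : \bar R := ((q i k)%:E * 'V_P[st u k]
  + (qb i k * mst u k ^+ (2 * p))%:E + (r i k)%:E * 'V_P[ctl u i k]
  + (rb i k * mctl u i k ^+ (2 * p))%:E)%E.
rewrite /cost -[X in (_ + X)%E]/(\sum_(0 <= k < N) term k)%E => fin.
have wV (x : R) (X : T -> R) : 0 < x -> (0 <= x%:E * 'V_P[X])%E.
  by move=> x0'; rewrite mule_ge0 ?variance_ge0// lee_fin ltW.
have wE (x y : R) : 0 < x -> (0 <= (x * y ^+ (2 * p))%:E)%E.
  by move=> x0'; rewrite lee_fin mulr_ge0 ?even_power_ge0// ltW.
have Vlt (x : R) (X : T -> R) : 0 < x -> (x%:E * 'V_P[X] < +oo)%E ->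
    ('V_P[X] < +oo)%E.
  move=> x0' h; rewrite ltey; apply/eqP => XV.
  by rewrite XV gt0_muley// in h.
have term_ge0 k : (k < N)%N -> (0 <= term k)%E.
  move=> kN; have kN' := ltnW kN.
  by rewrite /term !adde_ge0 ?wV ?wE ?q_gt0 ?qb_gt0 ?r_gt0 ?rb_gt0.
have sum_ge0 : (0 <= \sum_(0 <= k < N) term k)%E.
  by rewrite big_nat sume_ge0// => k /andP[_]; exact: term_ge0.
have term_fin k : (k < N)%N -> (term k < +oo)%E.
  move=> kN; apply: le_lt_trans fin.
  apply: (@le_trans _ _ (\sum_(0 <= k < N) term k)%E).
    rewrite big_mkord (bigD1 (Ordinal kN))//= leeDl// sume_ge0// => j _.
    exact: term_ge0.
  by rewrite leeDr// adde_ge0 ?wV ?wE ?q_gt0 ?qb_gt0.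
have VN : ('V_P[st u N] < +oo)%E.
  apply: (Vlt (q i N)); first exact: q_gt0.
  apply: le_lt_trans fin; rewrite -addeA leeDl// adde_ge0// wE//.
  exact: qb_gt0.
have Vs k : (k < N)%N -> ('V_P[st u k] < +oo)%E.
  move=> kN; have kN' := ltnW kN; apply: (Vlt (q i k)); first exact: q_gt0.
  apply: le_lt_trans (term_fin _ kN); rewrite /term -!addeA leeDl//.
  by rewrite !adde_ge0 ?wV ?wE ?q_gt0 ?qb_gt0 ?r_gt0 ?rb_gt0.
have Vc k : (k < N)%N -> ('V_P[ctl u i k] < +oo)%E.
  move=> kN; have kN' := ltnW kN; apply: (Vlt (r i k)); first exact: r_gt0.
  apply: le_lt_trans (term_fin _ kN).
  rewrite /term -addeA addeCA leeDl//.
  by rewrite !adde_ge0 ?wV ?wE ?q_gt0 ?qb_gt0 ?r_gt0 ?rb_gt0.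
split=> k kN; apply: Lfun2_of_variance.
- exact: past_measurableW (state_past _ kN).
- by move: kN; rewrite leq_eqVlt => /predU1P[->//|]; exact: Vs.
- exact: past_measurableW (control_past _ _ kN).
- exact: Vc.
Qed.

Lemma linear_Lfun2 : (forall k x xb, u i k x xb = ustar i k x xb) ->
  (x0 : T -> R) \in L2 ->
  (forall k, (k <= N)%N -> st u k \in L2) /\
  (forall k, (k < N)%N -> ctl u i k \in L2).
Proof.
move=> uE x02.
have ctl_of_st k : st u k \in L2 -> ctl u i k \in L2.
  move=> s2; rewrite (_ : ctl u i k = (fun t => - (G i k * a k) * st u k t
     + 1 * cst ((G i k * a k - Gb i k * a k) * mst u k) t)).
    by rewrite Lfun2_lin ?Lfun_cst.
  by apply/funext => t; rewrite /control uE /ustar /=; ring.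
have st2 k : (k <= N)%N -> st u k \in L2.
  elim: k => // k IH kN; have s2 := IH (ltnW kN).
  rewrite stateS Lfun2_lin//; first by rewrite Lfun2_lin// ctl_of_st.
  by rewrite rpredD//= ?lee1n ?Lfun_cst// (noise_Lfun2 i).
by split=> k kN; rewrite ?ctl_of_st ?st2// ltnW.
Qed.

End Profile.

Lemma expected_costE (u : 'I_n -> strategy R) i :
  expected_cost N p a b q qb r rb x0 eps u i = cost N p a b q qb r rb x0 eps u i.
Proof. by rewrite /expected_cost integral_cst//= probability_setT mule1. Qed.

Lemma linear_feedback_nash : nash_equilibrium N p a b q qb r rb x0 eps ustar.
Proof.
have ustar_adm : admissible N a b x0 eps ustar.
  apply: borel_admissible => i k kN.
  apply: measurable_funD; first by do 2 apply: measurable_funM => //.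
  apply: measurableT_comp => //; apply: measurable_funM => //.
  exact: measurable_funB.
split=> // i v v_adm; rewrite !expected_costE.
set u := deviate ustar i v.
have others j k x xb : j != i -> u j k x xb = ustar j k x xb.
  by rewrite /u /deviate => /negPf ->.
have [fin|] := ltP (cost N p a b q qb r rb x0 eps u i) +oo%E; last first.
  by rewrite leye_eq => /eqP ->; exact: leey.
have [st2 ctl2] := finite_cost_Lfun2 i u others v_adm fin.
have [st2' ctl2'] := linear_Lfun2 i ustar (fun _ _ _ _ _ => erefl)
  (fun _ _ _ => erefl) (st2 0%N (leq0n _)).
apply: le_trans (value_le_cost i u others v_adm st2 ctl2).
by rewrite -(value_eq_cost i ustar (fun _ _ _ _ _ => erefl) ustar_adm st2' ctl2').
Qed.

End Game.

Theorem proposition4 (d : measure_display) (T : measurableType d)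
  (R : realType) (P : probability T R)
  (p n N : nat) (hp : (1 <= p)%N) (hn : (2 <= n)%N) (hN : (1 <= N)%N)
  (a : nat -> R) (b q qb r rb : 'I_n -> nat -> R)
  (hq : forall i k, (k <= N)%N -> 0 < q i k)
  (hqb : forall i k, (k <= N)%N -> 0 < qb i k)
  (hr : forall i k, (k < N)%N -> 0 < r i k)
  (hrb : forall i k, (k < N)%N -> 0 < rb i k)
  (x0 : {RV P >-> R}) (eps : nat -> {RV P >-> R})
  (heps0 : forall w, eps 0%N w = 0)
  (hepsE : forall k, ('E_P[eps k] = 0)%E)
  (hepsC : centered_given_past eps)
  (hind : independent_of_process x0 eps)
  (c cb alpha alphab gammab : 'I_n -> nat -> R)
  (hc : forall i k, (k < N)%N ->
    c i k = alpha i k.+1 * b i k / (r i k + alpha i k.+1 * b i k ^+ 2))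
  (hcb : forall i k, (k < N)%N ->
    cb i k = odd_root (2 * p - 1) (alphab i k.+1 * b i k / rb i k)
      / (1 + odd_root (2 * p - 1) (alphab i k.+1 * b i k / rb i k) * b i k))
  (halphabN : forall i, alphab i N = qb i N)
  (hgammabN : forall i, gammab i N = 0)
  (halphaN : forall i, alpha i N = q i N)
  (halphab : forall i k, (k < N)%N ->
    alphab i k = qb i k
      + rb i k * (gain (cb^~ k) (b^~ k) i * a k) ^+ (2 * p)
      + alphab i k.+1 * (a k
          - \sum_(j < n) gain (cb^~ k) (b^~ k) j * a k * b j k) ^+ (2 * p))
  (hgammab : forall i k, (k < N)%N ->
    ((gammab i k)%:E = (gammab i k.+1)%:E
      + (alpha i k.+1)%:E * 'E_P[fun w => (eps k.+1 w ^+ 2)%R])%E)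
  (halpha : forall i k, (k < N)%N ->
    alpha i k = q i k
      + r i k * (gain (c^~ k) (b^~ k) i * a k) ^+ 2
      + alpha i k.+1 * (a k
          - \sum_(j < n) gain (c^~ k) (b^~ k) j * a k * b j k) ^+ 2) :
  nash_equilibrium N p a b q qb r rb x0 eps
    (fun i k x xb => - gain (cb^~ k) (b^~ k) i * (a k * xb)
                     - gain (c^~ k) (b^~ k) i * a k * (x - xb)).
Proof. by apply: (@linear_feedback_nash d T R P p n N hp) => //; eassumption. Qed.
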